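(* In the single-attribute setting, for any $p\in(-\infty,1]\setminus\{0\}$, given any query $q\in\mathbb{R}^d$ and an exact oracle ENN returning the $k$ most similar vectors to $q$ from any set, the algorithm p-Mean-ANN (using ENN in its fetching step) returns a size-$k$ subset $\textsc{Alg}\subseteq P$ satisfying $\textsc{Alg}\in\arg\max_{S\subseteq P:|S|=k}M_p(S)$. Furthermore, the algorithm runs in time $O(kc)+\sum_{\ell=1}^c\mathrm{ENN}(D_\ell,q)$, where $\mathrm{ENN}(D_\ell,q)$ is the time required by the exact oracle to find the $k$ most similar vectors to $q$ in $D_\ell$.
   Context: Setting: $P\subset\mathbb{R}^d$ finite, $\sigma:\mathbb{R}^d\times\mathbb{R}^d\to\mathbb{R}_{\ge0}$ a similarity function, $k$ a positive integer, $[c]=\{1,\dots,c\}$. In the single-attribute setting each $v\in P$ has exactly one attribute and $D_\ell$ is the set of vectors with attribute $\ell$ (a partition of $P$). For a query $q$ and $S\subseteq P$, $u_\ell(S)=\sum_{v\in S\cap D_\ell}\sigma(q,v)$. For fixed $\eta>0$, $M_p(S)=\big(\frac1c\sum_{\ell=1}^c(u_\ell(S)+\eta)^p\big)^{1/p}$; the $p$-NNS problem is $\max_{S\subseteq P,|S|=k}M_p(S)$. Algorithm p-Mean-ANN: (1) For each $\ell$, fetch via the oracle a set $\widehat D_\ell\subseteq D_\ell$ of $k$ nearest neighbors of $q$ in $D_\ell$; let $v^\ell_{(i)}$ be the $i$-th most similar vector to $q$ in $\widehat D_\ell$. (2) Initialize $\textsc{Alg}=\emptyset$, $k_\ell=0$,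 $w_\ell=0$. (3) While $|\textsc{Alg}|<k$: if $p\in(0,1]$ choose $a\in\arg\max_\ell\big((w_\ell+\eta+\sigma(q,v^\ell_{(k_\ell+1)}))^p-(w_\ell+\eta)^p\big)$; if $p<0$ choose $a\in\arg\min_\ell$ of the same quantity (ties arbitrary); add $v^a_{(k_a+1)}$ to $\textsc{Alg}$, set $w_a\leftarrow w_a+\sigma(q,v^a_{(k_a+1)})$, $k_a\leftarrow k_a+1$. (4) Return $\textsc{Alg}$. *)

(* Defs.v *)
From HB Require Import structures.
From mathcomp Require Import all_boot all_order all_algebra.
From mathcomp Require Export finmap.
From mathcomp Require Import reals exp.

Set Implicit Arguments.
Unset Strict Implicit.
Unset Printing Implicit Defensive.

Import Order.TTheory GRing.Theory Num.Theory.

Local Open Scope fset_scope.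
Local Open Scope ring_scope.

Section Problem.
Context (R : realType) (d c : nat).
Implicit Types (sigma : 'rV[R]_d -> 'rV[R]_d -> R) (q : 'rV[R]_d).
Implicit Types (P S T : {fset 'rV[R]_d}) (D : 'I_c -> {fset 'rV[R]_d}).

(* Labels are 0, ..., c - 1; some [D l] may be empty. *)
Definition single_attribute P D : Prop :=
  (forall l, D l `<=` P) /\ (forall v, v \in P -> exists! l, v \in D l).

Definition utility sigma q D S (l : 'I_c) : R :=
  \sum_(v <- S `&` D l) sigma q v.

Definition pmean sigma q D (eta p : R) S : R :=
  (c%:R^-1 * \sum_(l < c) (utility sigma q D S l + eta) `^ p) `^ p^-1.

Definition pNNS_optimal sigma q D (eta p : R) P (k : nat) S : Prop :=
  [/\ S `<=` P, #|` S| = k &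
      forall T, T `<=` P -> #|` T| = k ->
        pmean sigma q D eta p T <= pmean sigma q D eta p S].

(* [s] lists the [k] elements of [X] most similar to [q] (all of [X] if it has
   fewer than [k] elements), the most similar first; ties are arbitrary. *)
Definition knn_listing sigma (k : nat) q (X : {fset 'rV[R]_d})
    (s : seq 'rV[R]_d) : Prop :=
  [/\ uniq s, {subset s <= X}, size s = minn k #|` X|,
      sorted (fun x y => sigma q y <= sigma q x) s &
      forall x y, x \in s -> y \in X -> y \notin s -> sigma q y <= sigma q x].

Definition exact_oracle sigma (k : nat)
    (ENN : {fset 'rV[R]_d} -> 'rV[R]_d -> seq 'rV[R]_d) : Prop :=
  forall X q, knn_listing sigma k q X (ENN X q).

End Problem.

(* [Some (a, t)]: the program returns [a] after [t] time units.
   [None]: it has gone wrong, or it has exhausted the fuel of a while loop. *)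
Definition prog (A : Type) : Type := option (A * nat).

Definition ret A (a : A) : prog A := Some (a, 0%N).

Definition bind A B (m : prog A) (f : A -> prog B) : prog B :=
  if m is Some (a, t) then
    if f a is Some (b, u) then Some (b, (t + u)%N) else None
  else None.

Declare Scope prog_scope.
Notation "x <-- m ;; f" := (bind m (fun x => f))
  (at level 100, m at next level, right associativity) : prog_scope.
Local Open Scope prog_scope.

Definition abort {A} : prog A := None.

Definition spend (t : nat) : prog unit := Some (tt, t).

(* Unit-cost real RAM.  Each of the following costs one time unit: an
   arithmetic operation or comparison on reals or integers, a real power, an
   evaluation of the similarity function, a call to [tie], reading a register
   or the length of an array, reading or writing one of its cells, appending a
   cell to it.  Branching on the result of an operation is part of it.
   Each use of [op] performs exactly one of these.  Arrays are represented by
   sequences, or by functions on ['I_c] when they are indexed by labels. *)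
Definition op A (a : A) : prog A := Some (a, 1%N).

Definition read A (s : seq A) (i : nat) : prog A :=
  if onth s i is Some x then op x else abort.

Definition alloc (c : nat) A (x : A) : prog ('I_c -> A) :=
  Some (fun=> x, c).

Definition write (c : nat) A (f : 'I_c -> A) (l : 'I_c) (x : A) :
    prog ('I_c -> A) :=
  op (fun j => if j == l then x else f j).

Fixpoint for_each I A (s : seq I) (body : I -> A -> prog A) (a : A) : prog A :=
  _ <-- spend 1 ;;
  if s is i :: s' then b <-- body i a ;; for_each s' body b else ret a.

Fixpoint while A (fuel : nat) (test : A -> prog bool) (body : A -> prog A)
    (a : A) : prog A :=
  if fuel is n.+1 then
    b <-- test a ;;
    if b then a' <-- body a ;; while n test body a' else ret a
  else abort.

(* The fuel is not part of the computation: a program halts when its outcome is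
   the same for every large enough fuel. *)
Definition halts_with A (m : nat -> prog A) (a : A) (t : nat) : Prop :=
  exists N, forall n, (N <= n)%N -> m n = Some (a, t).

Record state (V R : Type) (c : nat) := State {
  alg : seq V;
  cnt : 'I_c -> nat;
  wgt : 'I_c -> R
}.

Section Algorithm.
Context (R : realType) (d c : nat).
Context (sigma : 'rV[R]_d -> 'rV[R]_d -> R) (k : nat) (eta p : R).
Context (D : 'I_c -> {fset 'rV[R]_d}) (q : 'rV[R]_d).
Context (ENN : {fset 'rV[R]_d} -> 'rV[R]_d -> seq 'rV[R]_d).
Context (timeENN : {fset 'rV[R]_d} -> 'rV[R]_d -> nat).
(* [tie s a l] tells whether, in state [s], label [l] supersedes the equally
   good label [a].  Since it depends on the whole state, any choice of an
   optimal label in each iteration is obtained from some [tie]. *)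
Context (tie : state 'rV[R]_d R c -> 'I_c -> 'I_c -> bool).

(* The answer of the oracle is copied cell by cell. *)
Definition fetch : prog ('I_c -> seq 'rV[R]_d) :=
  Dh0 <-- alloc c [::] ;;
  for_each (enum 'I_c) (fun l Dh =>
    _ <-- spend (timeENN (D l) q) ;;
    let s := ENN (D l) q in
    _ <-- spend (size s) ;;
    write Dh l s) Dh0.

(* (w_l + eta + sigma(q, v))^p - (w_l + eta)^p, for v of index k_l in Dh l
   (indices start at 0). *)
Definition gain (Dh : 'I_c -> seq 'rV[R]_d) (s : state 'rV[R]_d R c)
    (l : 'I_c) : prog R :=
  i <-- op (cnt s l) ;;
  v <-- read (Dh l) i ;;
  x <-- op (sigma q v) ;;
  w <-- op (wgt s l) ;;
  y <-- op (w + eta) ;;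
  z <-- op (y + x) ;;
  zp <-- op (z `^ p) ;;
  yp <-- op (y `^ p) ;;
  op (zp - yp).

Definition supersedes (s : state 'rV[R]_d R c) (a : 'I_c) (ga : R)
    (l : 'I_c) (gl : R) : prog bool :=
  e <-- op (gl == ga) ;;
  if e then op (tie s a l) else
  pos <-- op (0 < p) ;;
  if pos then op (ga < gl) else op (gl < ga).

(* Labels whose fetched vectors have all been used are skipped; there are none
   if every [D l] has at least [k] elements. *)
Definition best_label (Dh : 'I_c -> seq 'rV[R]_d) (s : state 'rV[R]_d R c) :
    prog (option ('I_c * R)) :=
  for_each (enum 'I_c) (fun l best =>
    i <-- op (cnt s l) ;;
    n <-- op (size (Dh l)) ;;
    available <-- op (i < n)%N ;;
    if available then
      gl <-- gain Dh s l ;;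
      current <-- op best ;;
      if current is Some (a, ga) then
        b <-- supersedes s a ga l gl ;;
        if b then op (Some (l, gl)) else ret best
      else op (Some (l, gl))
    else ret best) None.

Definition greedy_test (s : state 'rV[R]_d R c) : prog bool :=
  n <-- op (size (alg s)) ;;
  op (n < k)%N.

Definition greedy_step (Dh : 'I_c -> seq 'rV[R]_d) (s : state 'rV[R]_d R c) :
    prog (state 'rV[R]_d R c) :=
  best <-- best_label Dh s ;;
  _ <-- spend 1 ;;
  if best is Some (a, _) then
    i <-- op (cnt s a) ;;
    v <-- read (Dh a) i ;;
    alg' <-- op (rcons (alg s) v) ;;
    x <-- op (sigma q v) ;;
    w <-- op (wgt s a) ;;
    w' <-- op (w + x) ;;
    wgt' <-- write (wgt s) a w' ;;
    i' <-- op i.+1 ;;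
    cnt' <-- write (cnt s) a i' ;;
    ret (State alg' cnt' wgt')
  else abort.

Definition pMeanANN (fuel : nat) : prog (seq 'rV[R]_d) :=
  Dh <-- fetch ;;
  alg0 <-- op [::] ;;
  cnt0 <-- alloc c 0%N ;;
  wgt0 <-- alloc c 0 ;;
  s <-- while fuel greedy_test (greedy_step Dh) (State alg0 cnt0 wgt0) ;;
  op (alg s).

End Algorithm.

(* Main.v *)
Require Import Defs.
From HB Require Import structures.
From mathcomp Require Import all_boot all_order all_algebra.
From mathcomp Require Import finmap.
From mathcomp Require Import reals exp.
From mathcomp Require Import lra zify.

(** Put [f x = sg p * x ^ p].  For [p <= 1] it is concave and increasing on the
    positive reals, and maximizing [M_p] amounts to maximizing the sum over the
    labels [l] of [f (u_l + eta)].  If [S] takes [n] vectors from [D l], then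
    [u_l] is at most the total similarity of the first [n] vectors listed by the
    oracle, so one has to maximize a sum of functions [g_l] of the counts, whose
    increments decrease because [f] is concave and the oracle's list is sorted.
    The algorithm selects a largest increment each time, so after each iteration
    some threshold [z] is below all the increments collected so far and above
    all those still to come.  Hence [g_l n_l - g_l k_l <= z * (n_l - k_l)] for
    any counts [n_l], where [k_l] are the counts of the algorithm, and summing
    over [l] gives optimality since both families of counts sum to [k]. *)

Set Implicit Arguments.
Unset Strict Implicit.
Unset Printing Implicit Defensive.

Import Order.TTheory GRing.Theory Num.Theory.

Local Open Scope fset_scope.
Local Open Scope ring_scope.

(** * Tangent lines and increments of the signed power *)

Section SignedPower.
Context (R : realType).
Implicit Types p x y t : R.

Lemma ln_le_subr1 x : 0 < x -> ln x <= x - 1.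
Proof.
by move=> x0; have := @le_ln1Dx R (x - 1); rewrite [1 + _]addrC subrK; apply; lra.
Qed.

Lemma powR_le_tangent1 p t : 0 <= p -> p <= 1 -> 0 < t ->
  t `^ p <= 1 + p * (t - 1).
Proof.
move=> p0 p1 t0; set A := 1 + p * (t - 1).
(* [A] is the convex combination of [1] and [t] with weights [1 - p] and [p]. *)
have A0 : 0 < A by rewrite /A; nra.
rewrite -ler_ln ?posrE ?powR_gt0 // ln_powR.
(* [p ln t - ln A = p ln (t / A) + (1 - p) ln (1 / A)
     <= p (t / A - 1) + (1 - p) (1 / A - 1) = 0] *)
have := ln_le_subr1 (divr_gt0 t0 A0).
have A'0 : 0 < A^-1 by rewrite invr_gt0.
have := ln_le_subr1 A'0.
rewrite ln_div ?posrE // lnV ?posrE //.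
have : A * A^-1 = 1 by rewrite divff ?gt_eqF.
rewrite {1}/A; move: A^-1 (ln A) (ln t) => B a b; nra.
Qed.

(** Since [t ^ p = exp (p ln t) >= 1 + p ln t], the bound [ln t <= t - 1], multiplied by [p <= 0],
    concludes. *)
Lemma powR_ge_tangent1 p t : p <= 0 -> 0 < t -> 1 + p * (t - 1) <= t `^ p.
Proof.
move=> p0 t0.
rewrite -[t in t `^ p]lnK ?posrE // -expRM.
apply: le_trans (expR_ge1Dx _); have := ln_le_subr1 t0; nra.
Qed.

Definition spow p x : R := Num.sg p * x `^ p.

(** Concavity as a tangent bound at [y]. By homogeneity it reduces to the tangent at [1], taken at
    the point [x / y]; the slope uses [sg p * p = |p|]. *)
Lemma spow_le_tangent p x y : p <= 1 -> 0 < x -> 0 < y ->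
  spow p x <= spow p y + `|p| * y `^ p / y * (x - y).
Proof.
move=> p1 x0 y0; rewrite /spow.
have t0 : 0 < x / y by rewrite divr_gt0.
have -> : x `^ p = (x / y) `^ p * y `^ p.
  by rewrite -powRM ?divfK ?gt_eqF // ltW.
have -> : `|p| * y `^ p / y * (x - y) = `|p| * y `^ p * (x / y - 1).
  by rewrite -mulrA; congr (_ * _); rewrite mulrBr mulVf ?gt_eqF // mulrC.
have yp := powR_ge0 y p.
case: (ltrgt0P p) => [p0|p0|->]; last by rewrite sgr0; lra.
  rewrite gtr0_sg //; have := powR_le_tangent1 (ltW p0) p1 t0; nra.
rewrite ltr0_sg //; have := powR_ge_tangent1 (ltW p0) t0; nra.
Qed.

(** The tangent at [y] has nonnegative slope, so to the left of [y] it stays below [spow p y]. *)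
Lemma le_spow p x y : p <= 1 -> 0 < x -> x <= y -> spow p x <= spow p y.
Proof.
move=> p1 x0 xy; have y0 := lt_le_trans x0 xy.
apply: le_trans (spow_le_tangent p1 x0 y0) _.
rewrite gerDl; apply: mulr_ge0_le0; last by rewrite subr_le0.
by rewrite !mulr_ge0 ?powR_ge0 // invr_ge0 ltW.
Qed.

(* The slope of [spow p] at [x + h] bounds the left side above and the right side
   below. *)
Lemma spow_increment p x h h' : p <= 1 -> 0 < x -> 0 <= h' -> h' <= h ->
  spow p (x + h + h') - spow p (x + h) <= spow p (x + h) - spow p x.
Proof.
move=> p1 x0 h'0 h'h; set y := x + h.
have y0 : 0 < y by rewrite /y; lra.
have y'0 : 0 < y + h' by lra.
have := spow_le_tangent p1 x0 y0; have := spow_le_tangent p1 y'0 y0.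
have m0 : 0 <= `|p| * y `^ p / y.
  by rewrite !mulr_ge0 ?powR_ge0 // invr_ge0 ltW.
have -> : x - y = - h by rewrite /y; lra.
have -> : y + h' - y = h' by lra.
move: m0; move: (_ / y) => m; nra.
Qed.

(** Passes from signed sums to [M_p]: for [p < 0] the sign and the exponent [1 / p] both reverse the
    order. *)
Lemma le_powR_inv_spow p x y : p != 0 -> 0 < x -> 0 < y ->
  Num.sg p * x <= Num.sg p * y -> x `^ p^-1 <= y `^ p^-1.
Proof.
move=> p0 x0 y0; case: (ltrgt0P p) p0 => // p0 _.
  rewrite gtr0_sg // !mul1r => xy.
  by apply: ge0_ler_powR; rewrite // ?nnegrE ?invr_ge0 ltW.
rewrite ltr0_sg // !mulN1r lerN2 => yx.
rewrite -(opprK p^-1) powRN [leRHS]powRN lef_pV2 ?posrE ?powR_gt0 //.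
by apply: ge0_ler_powR; rewrite // ?nnegrE ?oppr_ge0 ?invr_le0 ltW.
Qed.

End SignedPower.

(** * Concave sequences and sums over best elements *)

(** [z] is a slope of a supporting line at [k]: it is compared only with the two increments next to
    [k], and concavity carries the comparison to all others. *)
Lemma concave_seq_chord (R : realDomainType) (g : nat -> R) (n k t : nat) (z : R) :
  (forall i, (i.+1 < n)%N -> g i.+2 - g i.+1 <= g i.+1 - g i) ->
  (k <= n)%N -> (t <= n)%N ->
  ((0 < k)%N -> z <= g k - g k.-1) -> ((k < n)%N -> g k.+1 - g k <= z) ->
  g t - g k <= z * (t%:R - k%:R).
Proof.
move=> cvx kn tn zl zu.
(* The induction also carries the bound on the next increment; [down] is the mirror image. *)
have up j : (k + j <= n)%N -> g (k + j)%N - g k <= z * j%:R /\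
    ((k + j < n)%N -> g (k + j).+1 - g (k + j)%N <= z).
  elim: j => [|j IH]; first by rewrite addn0 subrr mulr0.
  rewrite addnS => jn; have [|IH1 /(_ jn) IH2] := IH; first exact: ltnW.
  split; first by rewrite -natr1; lra.
  by move=> jn'; apply: le_trans IH2; apply: cvx.
have down j : (j <= k)%N -> g (k - j)%N - g k <= z * - j%:R /\
    ((j < k)%N -> z <= g (k - j)%N - g (k - j).-1).
  elim: j => [|j IH]; first by rewrite subn0 subrr oppr0 mulr0.
  move=> jk; have [|IH1 /(_ jk) IH2] := IH; first exact: ltnW.
  move: IH1 IH2 kn; rewrite subnS.
  have : (0 < k - j)%N by rewrite subn_gt0.
  case E: (k - j)%N => [//|i] _ /= IH1 IH2 kn.
  split; first by rewrite -natr1; lra.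
  move=> jk'; have {jk'}: (0 < i)%N by lia.
  case: i E IH1 IH2 => // i E _ IH2 _ /=.
  by apply: le_trans IH2 (cvx _ _); lia.
have [kt|tk] := leqP k t.
  by have [|+ _] := up (t - k)%N; rewrite subnKC // natrB.
have [|+ _] := down (k - t)%N; first exact: leq_subr.
by rewrite subKn ?natrB 1?ltnW // opprB.
Qed.

(* Compare both sums after subtracting [mu] from [f]: the terms common to both
   cancel, the others are [<= 0] on the left and [>= 0] on the right. *)
Lemma le_sum_top (R : numDomainType) (T : eqType) (f : T -> R) (mu : R)
    (x t : seq T) :
  uniq x -> uniq t -> size t = size x ->
  {in t, forall v, mu <= f v} -> (forall v, v \in x -> v \notin t -> f v <= mu) ->
  \sum_(v <- x) f v <= \sum_(v <- t) f v.
Proof.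
move=> ux ut sz ge_mu le_mu.
have shift r : \sum_(v <- r) (f v - mu) = \sum_(v <- r) f v - mu *+ size r.
  by rewrite sumrB big_const_seq count_predT iter_addr_0.
rewrite -(lerD2r (- (mu *+ size x))) -{2}sz -!shift.
rewrite (bigID (mem t)) [leRHS](bigID (mem x)) /=.
have -> : \sum_(v <- x | v \in t) (f v - mu) = \sum_(v <- t | v \in x) (f v - mu).
  rewrite -[LHS]big_filter -[RHS]big_filter; apply: perm_big; apply: uniq_perm.
  - by rewrite filter_uniq.
  - by rewrite filter_uniq.
  - by move=> v; rewrite !mem_filter andbC.
rewrite lerD2l; apply: (@le_trans _ _ 0).
  rewrite big_seq_cond; apply: sumr_le0 => v /andP[vx vt].
  by rewrite subr_le0 le_mu.
by rewrite big_seq_cond; apply: sumr_ge0 => v /andP[vt _]; rewrite subr_ge0 ge_mu.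
Qed.

(** * Prefixes of the oracle's list *)

Section TopK.
Context (R : realType) (d : nat) (sigma : 'rV[R]_d -> 'rV[R]_d -> R).
Context (k : nat) (q : 'rV[R]_d).
Implicit Types (X Y : {fset 'rV[R]_d}) (s : seq 'rV[R]_d).

Definition prefix_weight s i : R := \sum_(v <- take i s) sigma q v.

Lemma prefix_weightS s i : (i < size s)%N ->
  prefix_weight s i.+1 = prefix_weight s i + sigma q (nth 0 s i).
Proof.
by move=> si; rewrite /prefix_weight (take_nth 0) // -cats1 big_cat big_seq1.
Qed.

Lemma knn_listing_anti X s i j : knn_listing sigma k q X s ->
  (i <= j)%N -> (j < size s)%N -> sigma q (nth 0 s j) <= sigma q (nth 0 s i).
Proof.
case=> _ _ _ srt _ ij js.
have tr : transitive (fun x y => sigma q y <= sigma q x).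
  by move=> y x z yx zy; apply: le_trans zy yx.
apply: (sorted_leq_nth tr (fun x => lexx _) 0 srt) => //.
by rewrite inE (leq_ltn_trans ij).
Qed.

Lemma knn_listing_dominates X Y s : knn_listing sigma k q X s ->
  Y `<=` X -> (#|` Y| <= size s)%N ->
  \sum_(v <- Y) sigma q v <= prefix_weight s #|` Y|.
Proof.
move=> knn YX; have [us sX _ _ nearest] := knn; rewrite /prefix_weight.
case E: #|` Y| => [|m] ms.
  by move/eqP: E; rewrite cardfs_eq0 => /eqP->; rewrite big_seq_fset0 take0 big_nil.
(* [mu] is the similarity of the last, hence least similar, vector of the prefix [t]. *)
set t := take _ s; pose mu := sigma q (nth 0 s m).
have ut : uniq t by rewrite take_uniq.
have szt : size t = #|` Y| by rewrite size_takel // E.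
have ge_mu v : v \in t -> mu <= sigma q v.
  move=> vt; have := vt; rewrite -index_mem szt E => im.
  have <- : nth 0 s (index v t) = v by rewrite -(@nth_take m.+1) // nth_index.
  by apply: knn_listing_anti knn _ ms; rewrite -ltnS.
(* A vector outside [t] either comes later in the sorted list or is not listed at all. *)
have le_mu v : v \in X -> v \notin t -> sigma q v <= mu.
  move=> vX vt; have [vs|vs] := boolP (v \in s); last first.
    by apply: nearest => //; rewrite mem_nth.
  have := vs; rewrite -index_mem => iv.
  rewrite -(nth_index 0 vs); apply: knn_listing_anti knn _ iv.
  rewrite leqNgt; apply: contra vt => im.
  rewrite -(nth_index 0 vs) -(@nth_take m.+1 _ 0 (index v s) (ltnW im)).
  by rewrite mem_nth // size_takel // ltnW.
apply: (le_sum_top (mu := mu)) => // v vY vt.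
by apply: le_mu vt; apply: (fsubsetP YX).
Qed.

End TopK.

(** * Hoare-style rules with cost bounds *)

Section Runs.
Local Open Scope prog_scope.

Definition runs A (m : prog A) (n : nat) (Q : A -> Prop) : Prop :=
  if m is Some (a, t) then Q a /\ (t <= n)%N else False.

Lemma runs_weaken A (m : prog A) n n' (Q Q' : A -> Prop) :
  runs m n Q -> (n <= n')%N -> (forall a, Q a -> Q' a) -> runs m n' Q'.
Proof.
case: m => [[a t] [Qa tn] nn' QQ'|//].
by split; [apply: QQ' | apply: leq_trans nn'].
Qed.

Lemma runs_bind A B (m : prog A) (f : A -> prog B) n1 n2 Q1 Q2 :
  runs m n1 Q1 -> (forall a, Q1 a -> runs (f a) n2 Q2) ->
  runs (bind m f) (n1 + n2)%N Q2.
Proof.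
case: m => [[a t] [Qa tn] /(_ a Qa)|//] /=.
by case: (f a) => [[b u] [Qb un]|//]; split=> //; apply: leq_add.
Qed.

(** The invariant is indexed by the items already processed. Each item costs one extra unit, and so
    does detecting the end of the list. *)
Lemma runs_for_each (I : eqType) A (s : seq I) (body : I -> A -> prog A)
    (n : I -> nat) (Inv : seq I -> A -> Prop) (done : seq I) a :
  (forall done i a, Inv done a -> runs (body i a) (n i) (Inv (rcons done i))) ->
  Inv done a ->
  runs (for_each s body a) (\sum_(i <- s) (n i).+1).+1 (Inv (done ++ s)).
Proof.
move=> step; elim: s done a => [|i s IH] done a inv.
  by rewrite big_nil cats0; split.
rewrite big_cons /runs /=; have := step _ i _ inv; rewrite /runs.
case: (body i a) => [[b t]|//] [inv' tn] /=.
have := IH _ _ inv'; rewrite cat_rcons /runs.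
by case: for_each => [[b' u]|//] [inv'' un]; split=> //; lia.
Qed.

(** The index of the invariant is the number of iterations left. The run makes [m] iterations and
    one failing test, so any fuel above [m] gives the same outcome. *)
Lemma while_halts A (test : A -> prog bool) (body : A -> prog A) n1 n2
    (Inv : nat -> A -> Prop) m a :
  (forall m a, Inv m a -> runs (test a) n1 (fun b => b = (0 < m)%N)) ->
  (forall m a, Inv m.+1 a -> runs (body a) n2 (Inv m)) ->
  Inv m a ->
  exists b t, [/\ Inv 0%N b, (t <= m * (n1 + n2) + n1)%N &
    forall n, (m < n)%N -> while n test body a = Some (b, t)].
Proof.
move=> testP bodyP; elim: m a => [|m IH] a inv.
  have := testP _ _ inv.
  case E: (test a) => [[b t]|//] [/= bF tn]; subst b.
  exists a, t; split=> // -[//|n] _ /=.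
  by rewrite E /= addn0.
have := testP _ _ inv; have := bodyP _ _ inv.
case Eb: (body a) => [[a' u]|//] [inv' un].
case E: (test a) => [[b t]|//] [/= bT tn]; subst b.
have [b [t' [invb t'n bE]]] := IH _ inv'.
exists b, (t + (u + t'))%N; split=> //.
  by rewrite mulSn; lia.
by case=> // n mn /=; rewrite E /= Eb /= bE.
Qed.

End Runs.

(** * Counting vectors label by label *)

Section Partition.
Context (R : realType) (d c : nat) (P : {fset 'rV[R]_d}).
Context (D : 'I_c -> {fset 'rV[R]_d}) (part : single_attribute P D).

(** Double counting: each vector of [P] has exactly one label. *)
Lemma size_by_label (r : seq 'rV[R]_d) : {subset r <= P} ->
  size r = (\sum_(l < c) size [seq v <- r | v \in D l])%N.
Proof.
move=> rP; rewrite -sum1_size big_seq.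
under [RHS]eq_bigr => l _ do rewrite size_filter -sum1_count big_mkcond big_seq.
rewrite exchange_big; apply: eq_bigr => v /rP vP /=.
have [l [vl lE]] := part.2 v vP.
rewrite (bigD1 l) //= vl big1 ?addn0 // => j jl.
by case: ifP => // /lE lj; rewrite lj eqxx in jl.
Qed.

Lemma perm_fsetI (S : {fset 'rV[R]_d}) (r : seq 'rV[R]_d) l :
  uniq r -> S =i r -> perm_eq (S `&` D l) [seq v <- r | v \in D l].
Proof.
move=> ur Sr; apply: uniq_perm; rewrite ?fset_uniq ?filter_uniq // => v.
by rewrite mem_filter inE Sr andbC.
Qed.

Lemma card_by_label (S : {fset 'rV[R]_d}) : S `<=` P ->
  #|` S| = (\sum_(l < c) #|` S `&` D l|)%N.
Proof.
move=> /fsubsetP SP; rewrite (size_by_label SP); apply: eq_bigr => l _.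
by apply/esym/perm_size/perm_fsetI; rewrite ?fset_uniq.
Qed.

Lemma label_count_gt0 : (0 < #|` P|)%N -> (0 < c)%N.
Proof.
rewrite cardfs_gt0 => /fset0Pn[v /part.2[l _]].
exact: leq_ltn_trans (leq0n l) (ltn_ord l).
Qed.

End Partition.

(** Either no term exceeds [k] and the truncation has no effect, or one truncated term already
    equals [k]. This shows that enough vectors are fetched. *)
Lemma leq_sum_minn n k (m : 'I_n -> nat) : (k <= \sum_(i < n) m i)%N ->
  (k <= \sum_(i < n) minn k (m i))%N.
Proof.
move=> km; have [/forallP le_k|] := boolP [forall i, (m i <= k)%N].
  by under eq_bigr => i _ do rewrite (minn_idPr (le_k i)).
rewrite negb_forall => /existsP[i]; rewrite -ltnNge => ki.
by rewrite (bigD1 i) //= (minn_idPl (ltnW ki)) leq_addr.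
Qed.

(** * Invariant, cost and optimality of the greedy loop *)

Section Greedy.
Context (R : realType) (d c : nat).
Context (sigma : 'rV[R]_d -> 'rV[R]_d -> R) (k : nat) (eta p : R).
Context (P : {fset 'rV[R]_d}) (D : 'I_c -> {fset 'rV[R]_d}) (q : 'rV[R]_d).
Context (tie : state 'rV[R]_d R c -> 'I_c -> 'I_c -> bool).
Context (Dh : 'I_c -> seq 'rV[R]_d).
Context (sigma_ge0 : forall x y, 0 <= sigma x y).
Context (kP : (k <= #|` P|)%N).
Context (part : single_attribute P D).
Context (eta0 : 0 < eta).
Context (p1 : p <= 1).
Context (p0 : p != 0).
Context (knn : forall l, knn_listing sigma k q (D l) (Dh l)).

Implicit Types (s : state 'rV[R]_d R c) (l a : 'I_c).

(** The function [g_l] of the count, followed by its increments. *)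
Let value l i := spow p (prefix_weight sigma q (Dh l) i + eta).
Let marginal l i := value l i.+1 - value l i.

Definition available s l := (cnt s l < size (Dh l))%N.

(** The default [0] of [nth] is never reached when [l] is available. *)
Definition gain_value s l : R :=
  (wgt s l + eta + sigma q (nth 0 (Dh l) (cnt s l))) `^ p - (wgt s l + eta) `^ p.

Lemma read_nth l i : (i < size (Dh l))%N -> read (Dh l) i = op (nth 0 (Dh l) i).
Proof. by move=> il; rewrite /read onthE (nth_map 0). Qed.

Lemma gainE s l : available s l ->
  gain sigma eta p q Dh s l = Some (gain_value s l, 9).
Proof. by move=> sl; rewrite /gain /= read_nth. Qed.

(** The factor [sg p] merges the argmax rule ([p > 0]) with the argmin rule ([p < 0]); in a tie both
    inequalities hold, whatever [tie] answers. *)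
Lemma supersedes_runs s a ga l gl :
  runs (supersedes p tie s a ga l gl) 3 (fun b =>
    if b then Num.sg p * ga <= Num.sg p * gl
    else Num.sg p * gl <= Num.sg p * ga).
Proof.
rewrite /supersedes /=; case: eqP => [->|_] /=; first by case: (tie s a l).
case: (ltrgt0P p) p0 => //= p_sg _.
  by rewrite gtr0_sg // !mul1r; case: ltP => // /ltW.
by rewrite ltr0_sg // !mulN1r !lerN2; case: ltP => // /ltW.
Qed.

Lemma best_label_runs s :
  runs (best_label sigma eta p q tie Dh s) (18 * c + 1) (fun best =>
    if best is Some (a, _) then available s a /\ forall l, available s l ->
      Num.sg p * gain_value s l <= Num.sg p * gain_value s a
    else forall l, ~~ available s l).
Proof.
pose Inv (done : seq 'I_c) (best : option ('I_c * R)) :=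
  if best is Some (a, ga) then [/\ available s a, ga = gain_value s a &
    forall l, l \in done -> available s l ->
      Num.sg p * gain_value s l <= Num.sg p * gain_value s a]
  else forall l, l \in done -> ~~ available s l.
apply: (@runs_weaken _ _ (\sum_(l <- enum 'I_c) 18).+1 _ (Inv (enum 'I_c))).
(* 3 operations for availability, 9 for the gain, 1 to read [best], at most 3 to compare and 1 to
   update. *)
- apply: (@runs_for_each _ _ _ _ (fun=> 17) Inv [::]) => //.
  move=> done l best inv /=.
  rewrite -/(available s l); case: ifPn => [sl|sl]; last first.
    split=> //; case: best inv => [[a ga] [sa -> le_a]|none].
      split=> // j; rewrite mem_rcons inE => /orP[/eqP->|/le_a //].
      by rewrite (negPf sl).
    by move=> j; rewrite mem_rcons inE => /orP[/eqP->|/none].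
  rewrite gainE //=.
  case: best inv => [[a ga] [sa -> le_a]|none] /=; last first.
    split=> //; split=> // j; rewrite mem_rcons inE.
    by case/orP=> [/eqP-> //|/none/negP].
  have := supersedes_runs s a (gain_value s a) l (gain_value s l).
  case: (supersedes _ _ _ _ _ _ _) => [[b t] [bP tn]|//] /=.
  case: b bP => bP /=; split; [split=> // j | lia | split=> // j | lia];
    rewrite mem_rcons inE => /orP[/eqP-> //|/le_a le_j /le_j //].
  by move=> le_j'; apply: le_trans bP.
- by rewrite big_const_seq count_predT -cardE card_ord iter_addn_0 addn1.
- case=> [[a ga] [sa _ le_a]|none]; last by move=> l; rewrite none ?mem_enum.
  by split=> // l; apply: le_a; rewrite mem_enum.
Qed.

Record greedy_invariant (s : state 'rV[R]_d R c) : Prop := GreedyInvariant {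
  inv_uniq : uniq (alg s);
  inv_sub : {subset alg s <= P};
  inv_perm : forall l,
    perm_eq [seq v <- alg s | v \in D l] (take (cnt s l) (Dh l));
  inv_cnt : forall l, (cnt s l <= size (Dh l))%N;
  inv_wgt : forall l, wgt s l = prefix_weight sigma q (Dh l) (cnt s l);
  (* A threshold separating the marginals already collected from the others. *)
  inv_threshold : exists z, forall l,
    ((0 < cnt s l)%N -> z <= marginal l (cnt s l).-1) /\
    (available s l -> marginal l (cnt s l) <= z)
}.

Lemma size_alg s : greedy_invariant s -> size (alg s) = (\sum_(l < c) cnt s l)%N.
Proof.
case=> _ sub perm le_cnt _ _; rewrite (size_by_label part sub).
by apply: eq_bigr => l _; rewrite (perm_size (perm l)) size_takel.
Qed.

(** Guarantees that no iteration aborts: if every list were exhausted, all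
    [sum_l min(k, |D l|) >= k] fetched vectors would have been chosen. *)
Lemma exists_available s : greedy_invariant s -> (size (alg s) < k)%N ->
  exists l, available s l.
Proof.
move=> inv sk; apply/existsP; apply: contraLR sk.
rewrite negb_exists -leqNgt => /forallP none; rewrite (size_alg inv).
apply: (@leq_trans (\sum_(l < c) minn k #|` D l|)).
  apply: leq_sum_minn; rewrite (leq_trans kP) // (card_by_label part) //.
  by apply: leq_sum => l _; rewrite fsubset_leq_card // fsubsetIr.
apply: leq_sum => l _; have [_ _ <- _ _] := knn l.
by rewrite leqNgt; apply: none.
Qed.

Lemma prefix_weight_ge0 l i : 0 <= prefix_weight sigma q (Dh l) i.
Proof. by apply: sumr_ge0. Qed.

Lemma marginalS l i : (i.+1 < size (Dh l))%N -> marginal l i.+1 <= marginal l i.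
Proof.
move=> il; have i_lt := ltnW il.
rewrite /marginal /value (prefix_weightS _ _ il) (prefix_weightS _ _ i_lt).
have -> h h' : prefix_weight sigma q (Dh l) i + h + h' + eta =
    prefix_weight sigma q (Dh l) i + eta + h + h' by lra.
rewrite (addrAC _ _ eta); apply: spow_increment => //.
  by rewrite ltr_wpDl // prefix_weight_ge0.
by apply: (knn_listing_anti (knn l)).
Qed.

Lemma sg_gain_value s l : greedy_invariant s -> available s l ->
  Num.sg p * gain_value s l = marginal l (cnt s l).
Proof.
move=> inv sl; rewrite /gain_value (inv_wgt inv) addrAC -prefix_weightS //.
by rewrite mulrBr.
Qed.

(** The effect of one iteration that picks [a], freed from its cost. *)
Definition select s a : state 'rV[R]_d R c :=
  let v := nth 0 (Dh a) (cnt s a) in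
  State (rcons (alg s) v) (fun l => if l == a then (cnt s a).+1 else cnt s l)
    (fun l => if l == a then wgt s a + sigma q v else wgt s l).

Lemma mem_label_uniq v l j : v \in D l -> v \in D j -> l = j.
Proof.
move=> vl vj; have [i [_ iE]] := part.2 v (fsubsetP (part.1 l) v vl).
by rewrite -(iE l vl) -(iE j vj).
Qed.

Lemma select_invariant s a : greedy_invariant s -> available s a ->
  (forall l, available s l -> marginal l (cnt s l) <= marginal a (cnt s a)) ->
  greedy_invariant (select s a).
Proof.
move=> inv sa best; set v := nth 0 (Dh a) (cnt s a).
have [u_a sub_a _ _ _] := knn a.
have va : v \in D a by apply/sub_a/mem_nth.
split=> /=.
(* The vectors of label [a] already chosen have index below [cnt s a] in a list without
   repetition. *)
- rewrite rcons_uniq (inv_uniq inv) andbT; apply/negP => vs.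
  have : v \in [seq w <- alg s | w \in D a] by rewrite mem_filter va.
  rewrite (perm_mem (inv_perm inv a)) => /(nthP 0)[i].
  rewrite size_takel ?(inv_cnt inv) // => i_lt; rewrite nth_take // => /eqP.
  by rewrite nth_uniq ?(ltn_trans i_lt) // ltn_eqF.
- move=> w; rewrite mem_rcons inE => /orP[/eqP->|]; last exact: inv_sub inv _.
  exact: (fsubsetP (part.1 a)).
- move=> l; rewrite filter_rcons; case: eqP => [->|/eqP la].
    by rewrite va (take_nth 0) // perm_rcons perm_sym perm_rcons perm_sym
      perm_cons (inv_perm inv).
  case: ifP => [vl|_]; last exact: inv_perm inv l.
  by rewrite (mem_label_uniq vl va) eqxx in la.
- by move=> l; case: eqP => [->//|_]; exact: inv_cnt inv l.
- move=> l; case: eqP => [->|_]; last exact: inv_wgt inv l.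
  by rewrite prefix_weightS // (inv_wgt inv).
(* The selected marginal is the new threshold. It is at most the old one, hence below what the other
   labels collected; what remains is below it by maximality, and by [marginalS] for [a] itself. *)
- have [z zP] := inv_threshold inv; exists (marginal a (cnt s a)) => l.
  rewrite /available /=; case: eqP => [->|_]; first by split=> // /marginalS.
  split=> [|/best //] l0; apply: le_trans ((zP l).1 l0).
  exact: (zP a).2.
Qed.

Lemma greedy_step_runs s : greedy_invariant s -> (size (alg s) < k)%N ->
  runs (greedy_step sigma eta p q tie Dh s) (18 * c + 11) (fun s' =>
    greedy_invariant s' /\ size (alg s') = (size (alg s)).+1).
Proof.
move=> inv sk; rewrite (_ : 18 * c + 11 = (18 * c + 1) + 10)%N; last by lia.
apply: runs_bind (best_label_runs s) _ => -[[a ga] [sa best]|none]; last first.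
  by have [l] := exists_available inv sk; rewrite (negPf (none l)).
rewrite /= read_nth //=; split=> //; rewrite -/(select s a); split.
  apply: select_invariant => // l sl.
  by rewrite -!(sg_gain_value inv) //; apply: best.
by rewrite size_rcons.
Qed.

Definition greedy_start : state 'rV[R]_d R c := State [::] (fun=> 0%N) (fun=> 0).

Lemma start_invariant : greedy_invariant greedy_start.
Proof.
split=> //= [l|l|]; first by rewrite take0.
  by rewrite /prefix_weight take0 big_nil.
(* Nothing is collected yet, so any common upper bound of the first marginals will do. *)
exists (\sum_(l < c) `|marginal l 0|) => l; split=> // _.
rewrite (bigD1 l) //=; apply: le_trans (ler_norm _) _.
by rewrite lerDl sumr_ge0.
Qed.

Lemma greedy_loop : exists s t,
  [/\ greedy_invariant s, size (alg s) = k, (t <= k * (18 * c + 13) + 2)%N &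
    forall n, (k < n)%N -> while n (greedy_test k)
      (greedy_step sigma eta p q tie Dh) greedy_start = Some (s, t)].
Proof.
(* [m] is the number of vectors still to be chosen. *)
pose Inv m s := greedy_invariant s /\ (size (alg s) + m = k)%N.
have [|||s [t [[inv sk] t_le sE]]] := @while_halts _ (greedy_test k)
    (greedy_step sigma eta p q tie Dh) 2 (18 * c + 11) Inv k greedy_start.
- by move=> m s [_ <-]; split=> //=; rewrite -{1}[size _]addn0 ltn_add2l.
- move=> m s [inv sk]; apply: runs_weaken (greedy_step_runs inv _) (leqnn _) _.
    by rewrite -sk -addSnnS leq_addr.
  by move=> s' [inv' s'k]; split=> //; rewrite s'k addSnnS.
- by split=> //; exact: start_invariant.
by exists s, t; split=> //; [rewrite -sk addn0 | lia].
Qed.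

Lemma utility_ge0 S l : 0 <= utility sigma q D S l.
Proof. by apply: sumr_ge0. Qed.

Lemma final_utility s l : greedy_invariant s ->
  utility sigma q D [fset v in alg s] l = prefix_weight sigma q (Dh l) (cnt s l).
Proof.
move=> inv; apply: perm_big; apply: perm_trans (inv_perm inv l).
by apply: perm_fsetI (inv_uniq inv) _ => v; rewrite inE.
Qed.

Lemma greedy_spow_optimal s T : greedy_invariant s -> size (alg s) = k ->
  T `<=` P -> #|` T| = k ->
  \sum_(l < c) spow p (utility sigma q D T l + eta) <=
  \sum_(l < c) spow p (utility sigma q D [fset v in alg s] l + eta).
Proof.
move=> inv sk TP Tk; pose n l := #|` T `&` D l|.
(* As [T] has [k] elements, [n l] is at most [min(k, |D l|)], the length of the oracle's list. *)
have n_le l : (n l <= size (Dh l))%N.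
  have [_ _ -> _ _] := knn l; rewrite leq_min -Tk.
  by rewrite !fsubset_leq_card ?fsubsetIl ?fsubsetIr.
have [z zP] := inv_threshold inv.
apply: (@le_trans _ _ (\sum_(l < c) value l (n l))).
  apply: ler_sum => l _; apply: le_spow => //.
    by rewrite ltr_wpDl ?utility_ge0.
  rewrite lerD2r; apply: knn_listing_dominates (knn l) _ (n_le l).
  exact: fsubsetIr.
under [leRHS]eq_bigr => l _ do rewrite final_utility // -/(value l _).
rewrite -subr_le0 -sumrB.
apply: (@le_trans _ _ (\sum_(l < c) z * ((n l)%:R - (cnt s l)%:R))).
  apply: ler_sum => l _; have [zl zu] := zP l.
  have {}zl : (0 < cnt s l)%N -> z <= value l (cnt s l) - value l (cnt s l).-1.
    by move=> l0; have := zl l0; rewrite /marginal prednK.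
  by apply: concave_seq_chord (inv_cnt inv l) (n_le l) zl zu => i; apply: marginalS.
rewrite -mulr_sumr sumrB -!natr_sum -(card_by_label part TP) Tk.
by rewrite -(size_alg inv) sk subrr mulr0.
Qed.

Lemma greedy_optimal s : greedy_invariant s -> size (alg s) = k -> (0 < k)%N ->
  pNNS_optimal sigma q D eta p P k [fset v in alg s].
Proof.
move=> inv sk k0; split.
- by apply/fsubsetP => v; rewrite inE; exact: inv_sub inv v.
- rewrite -sk; apply/perm_size/uniq_perm; rewrite ?fset_uniq ?(inv_uniq inv) //.
  by move=> v; rewrite inE.
move=> T TP Tk; rewrite /pmean.
have c0 := label_count_gt0 part (leq_trans k0 kP).
(* The means are positive because [eta > 0] and, [P] being nonempty, there is at least one label. *)
have pos S : 0 < c%:R^-1 * \sum_(l < c) (utility sigma q D S l + eta) `^ p.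
  rewrite mulr_gt0 ?invr_gt0 ?ltr0n // (bigD1 (Ordinal c0)) //=.
  rewrite ltr_pwDl ?sumr_ge0 // => [|l _]; last exact: powR_ge0.
  by rewrite powR_gt0 // ltr_wpDl ?utility_ge0.
apply: le_powR_inv_spow; rewrite ?pos // ![Num.sg p * _]mulrCA !mulr_sumr.
rewrite -!mulr_sumr ler_pM2l ?invr_gt0 ?ltr0n //.
have := greedy_spow_optimal inv sk TP Tk.
by rewrite /spow -!mulr_sumr.
Qed.

End Greedy.

(** * Cost of the fetching step *)

Section Fetch.
Context (R : realType) (d c : nat).
Context (k : nat) (D : 'I_c -> {fset 'rV[R]_d}) (q : 'rV[R]_d).
Context (ENN : {fset 'rV[R]_d} -> 'rV[R]_d -> seq 'rV[R]_d).
Context (timeENN : {fset 'rV[R]_d} -> 'rV[R]_d -> nat).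

(** Besides the oracle's time, each label costs at most [k] copies, one write and one loop unit; the
    array takes [c] units and the end of the loop one. *)
Lemma fetch_runs : (forall l, size (ENN (D l) q) <= k)%N ->
  runs (fetch D q ENN timeENN)
    (c + (\sum_(l < c) (timeENN (D l) q + k.+1).+1).+1)
    (fun Dh => forall l, Dh l = ENN (D l) q).
Proof.
move=> szk; apply: (@runs_bind _ _ _ _ _ _ xpredT) => // Dh0 _.
pose Inv (done : seq 'I_c) (Dh : 'I_c -> seq 'rV[R]_d) :=
  forall l, l \in done -> Dh l = ENN (D l) q.
rewrite -big_enum.
apply: (@runs_weaken _ _ _ _ (Inv (enum 'I_c)) _ _ (leqnn _)); last first.
  by move=> Dh Dh_eq l; apply: Dh_eq; rewrite mem_enum.
apply: (@runs_for_each _ _ _ _ _ Inv [::]) => // done l Dh inv /=.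
split; first by move=> j; rewrite mem_rcons inE; case: eqP => [->|_ /inv].
by have := szk l; lia.
Qed.

End Fetch.

(** * Assembling correctness and running time *)

Theorem theorem4 (R : realType) :
  exists C : nat,
  forall (d c k : nat) (sigma : 'rV[R]_d -> 'rV[R]_d -> R)
    (P : {fset 'rV[R]_d}) (D : 'I_c -> {fset 'rV[R]_d}) (eta p : R)
    (ENN : {fset 'rV[R]_d} -> 'rV[R]_d -> seq 'rV[R]_d)
    (timeENN : {fset 'rV[R]_d} -> 'rV[R]_d -> nat)
    (tie : state 'rV[R]_d R c -> 'I_c -> 'I_c -> bool)
    (q : 'rV[R]_d),
  (forall x y, 0 <= sigma x y) ->
  (0 < k)%N -> (k <= #|` P|)%N ->
  single_attribute P D ->
  0 < eta -> p <= 1 -> p != 0 ->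
  exact_oracle sigma k ENN ->
  exists (Alg : seq 'rV[R]_d) (t : nat),
    [/\ halts_with (pMeanANN sigma k eta p D q ENN timeENN tie) Alg t,
        pNNS_optimal sigma q D eta p P k [fset v in Alg] &
        (t <= C * (k * c) + \sum_(l < c) timeENN (D l) q)%N].
Proof.
(* Apart from the oracle, the cost is at most [19 k c + 13 k + 5 c + 5], which is at most [42 k c]
   since [k] and [c] are positive. *)
exists 42 => d c k sigma P D eta p ENN timeENN tie q.
move=> sigma0 k0 kP part eta0 p1 p0 exactENN.
have szk l : (size (ENN (D l) q) <= k)%N.
  by have [_ _ -> _ _] := exactENN (D l) q; rewrite geq_minl.
have := fetch_runs timeENN szk.
case fetchE: (fetch _ _ _ _) => [[Dh t0]|//] [Dh_eq t0_le].
have knn l : knn_listing sigma k q (D l) (Dh l) by rewrite Dh_eq; exact: exactENN.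
have [s [t [inv sk t_le loopE]]] := greedy_loop tie sigma0 kP part eta0 p1 p0 knn.
exists (alg s), (t0 + (1 + (c + (c + (t + 1)))))%N; split.
- by exists k.+1 => n kn; rewrite /pMeanANN fetchE /= loopE.
- exact: greedy_optimal inv sk k0.
have c0 := label_count_gt0 part (leq_trans k0 kP).
move: t0_le t_le; under eq_bigr => l _ do rewrite -addnS.
rewrite big_split /= sum_nat_const card_ord.
move: (\sum_(l < c) _)%N => S; nia.
Qed.
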